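(* Let ${}^\bullet\mathbb{R}$ be the ring of Fermat reals with Giordano's order $\le$. For distinct $x,y\in{}^\bullet\mathbb{R}$, define $x<_F y$ if and only if at least one of the following holds: (i) there exists $l\in{}^\bullet\mathbb{R}$ such that $x\in\{k\in{}^\bullet\mathbb{R}: k\le l\}$ and $y\notin\{k\in{}^\bullet\mathbb{R}: k\le l\}$; (ii) $x=\max\{k\in{}^\bullet\mathbb{R}: k\le l\}$ for some $l\in{}^\bullet\mathbb{R}$, and there exists $h\in{}^\bullet\mathbb{R}$ with $h>0$ and $y=x+h$; (iii) $y=\min\{k\in{}^\bullet\mathbb{R}: l\le k\}$ for some $l\in{}^\bullet\mathbb{R}$, and there exists $h\in{}^\bullet\mathbb{R}$ with $h>0$ and $x=y-h$. Then ${}^\bullet\mathbb{R}$, equipped with the order topology from $<_F$, is a LOTS (linearly ordered topological space).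
   Context: A little-oh polynomial is a function $x:\mathbb{R}_{\ge 0}\to\mathbb{R}$, $t\mapsto x_t$, such that $x_t=r+\sum_{i=1}^k\alpha_i t^{a_i}+o(t)$ as $t\to0^+$, for some $k\in\mathbb{N}$, $r,\alpha_1,\dots,\alpha_k\in\mathbb{R}$ and $a_1,\dots,a_k\in\mathbb{R}_{\ge0}$. The set of all little-oh polynomials is denoted $\mathbb{R}_o[t]$. For $x,y\in\mathbb{R}_o[t]$ put $x\sim y$ (also written ''$x=y$ in ${}^\bullet\mathbb{R}$'') if and only if $x_t=y_t+o(t)$ as $t\to0^+$. This is an equivalence relation, and the ring of Fermat reals is ${}^\bullet\mathbb{R}:=\mathbb{R}_o[t]/\sim$, with addition and multiplication induced by the pointwise operations. Giordano's order on ${}^\bullet\mathbb{R}$: for $x,y\in{}^\bullet\mathbb{R}$ (identified with representatives $x_t,y_t$), $x\le y$ if and only if there exists a little-oh polynomial $z$ with $z=0$ in ${}^\bullet\mathbb{R}$ (i.e. $\lim_{t\to0^+}z_t/t=0$) such that $x_t\le y_t+z_t$ for every sufficiently small $t\ge0$. This does not depend on the choice of representatives. The strict relation $a<b$ (equivalently $b>a$) means $a\le b$ and $a\ne b$ in ${}^\bullet\mathbb{R}$. The maxima and minima in the definition of $<_F$ are taken with respect to $\le$. The order topology from $<_F$ is the topology with subbasis consisting of the sets $\{k\in{}^\bullet\mathbb{R}: k<_F l\}$ and $\{k\in{}^\bullet\mathbb{R}: l<_F k\}$, $l\in{}^\bullet\mathbb{R}$. A LOTS is a topological space whose topology is the order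 topology of some linear order on its underlying set. *)

(* Defs.v *)
From HB Require Import structures.
From mathcomp Require Import all_boot all_order all_algebra.
From mathcomp Require Import generic_quotient ring_quotient finmap.
From mathcomp Require Import all_classical all_reals all_analysis.
From mathcomp Require Import lra.

Set Implicit Arguments.
Unset Strict Implicit.
Unset Printing Implicit Defensive.

Import Order.TTheory GRing.Theory Num.Theory.
Import numFieldNormedType.Exports.

Local Open Scope classical_set_scope.
Local Open Scope ring_scope.
Local Open Scope quotient_scope.

Section LittleOh.
Variable R : realType.
Implicit Types (x y z : {nonneg R} -> R) (t : {nonneg R}).

(* [near0] contains t = 0 and expresses "for every sufficiently small
   t >= 0"; [near0p] leaves t = 0 out and expresses "as t -> 0+". *)
Definition near0 : set_system {nonneg R} :=
  filter_from [set d : R | 0 < d] (fun d => [set t | t%:num < d]).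

Definition near0p : set_system {nonneg R} := within [set t | 0 < t%:num] near0.

Global Instance near0_filter : Filter near0.
Proof.
apply: filter_from_filter; first by exists 1 => /=.
move=> d e d0 e0; exists (Num.min d e); first by rewrite /= lt_min; apply/andP.
by move=> t /=; rewrite lt_min => /andP.
Qed.

Global Instance near0p_filter : ProperFilter near0p.
Proof.
apply: Build_ProperFilter_ex => A [d /= d0 dA]; have d20 : 0 <= d / 2 by rewrite divr_ge0// ltW.
exists (NngNum d20); apply: dA => /=; last by rewrite divr_gt0.
by rewrite ltr_pdivrMr// ltr_pMr// ltr1n.
Qed.

Lemma near0p_sub (A : set {nonneg R}) : near0 A -> near0p A.
Proof. by move=> A0; apply: filterS A0. Qed.

Lemma near0pT : near0p [set t | 0 < t%:num].
Proof. exact: withinT. Qed.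

Lemma near0_lt (d : R) : 0 < d -> near0 [set t | t%:num < d].
Proof. by move=> d0; exists d. Qed.

(* The value z_0 is unconstrained. *)
Definition is_littleo z : Prop := z t / t%:num @[t --> near0p] --> (0 : R).

(* Little-oh polynomials; the convention 0 `^ 0 = 1 is immaterial, t = 0 being
   ignored by [is_littleo]. *)
Definition is_lopoly x : Prop :=
  exists (k : nat) (r : R) (alpha a : 'I_k -> R), (forall i, 0 <= a i) /\
    is_littleo (fun t => x t - (r + \sum_(i < k) alpha i * t%:num `^ a i)).

Lemma is_littleo0 : is_littleo (fun=> 0).
Proof. by rewrite /is_littleo; under eq_cvg do rewrite mul0r; exact: cvg_cst. Qed.

Lemma is_littleoD x y :
  is_littleo x -> is_littleo y -> is_littleo (fun t => x t + y t).
Proof.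
move=> xo yo; rewrite /is_littleo; under eq_cvg do rewrite mulrDl.
by have := cvgD xo yo; rewrite addr0; exact.
Qed.

Lemma is_littleoN x : is_littleo x -> is_littleo (fun t => - x t).
Proof.
move=> xo; rewrite /is_littleo; under eq_cvg do rewrite mulNr.
by have := cvgN xo; rewrite oppr0; exact.
Qed.

Lemma is_littleoB x y :
  is_littleo x -> is_littleo y -> is_littleo (fun t => x t - y t).
Proof. by move=> xo yo; apply: is_littleoD => //; exact: is_littleoN. Qed.

Lemma is_littleoM x y (M : R) : near0p [set t | `|x t| <= M] ->
  is_littleo y -> is_littleo (fun t => x t * y t).
Proof.
move=> xM yo; apply: norm_cvg0.
have My : (M * `|y t / t%:num|) @[t --> near0p] --> (0 : R).
  by have := cvgM (cvg_cst M) (cvg_norm yo); rewrite normr0 mulr0; exact.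
apply: squeeze_cvgr (cvg_cst 0) My.
near=> t; rewrite normr_ge0/= -mulrA normrM ler_wpM2r//.
by near: t.
Unshelve. all: by end_near. Qed.

Lemma is_littleo_eq x y : (forall t, x t = y t) -> is_littleo x -> is_littleo y.
Proof. by move=> /funext ->. Qed.

Definition genpoly (s : seq (R * R)) t : R := \sum_(p <- s) p.1 * t%:num `^ p.2.

Lemma is_lopolyP x : is_lopoly x <->
  exists2 s, all (fun p => 0 <= p.2) s & is_littleo (fun t => x t - genpoly s t).
Proof.
split=> [[k [r [alpha [a [a0 xo]]]]]|[s s0 xo]].
  exists ((r, 0) :: [seq (alpha i, a i) | i <- enum 'I_k]).
    by rewrite /= lexx; apply/allP => _ /mapP[i _ ->] /=.
  apply: is_littleo_eq xo => t.
  by rewrite /genpoly big_cons big_map big_enum/= powRr0 mulr1.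
exists (size s), 0, (fun i => (tnth (in_tuple s) i).1),
  (fun i => (tnth (in_tuple s) i).2); split.
  by move=> i; apply: (allP s0); exact: mem_tnth.
apply: is_littleo_eq xo => t.
by rewrite add0r /genpoly [in LHS]big_tnth.
Qed.

Lemma genpoly_bounded s : all (fun p => 0 <= p.2) s ->
  exists M, near0p [set t | `|genpoly s t| <= M].
Proof.
move=> s0; exists (\sum_(p <- s) `|p.1|); near=> t.
have t1 : t%:num <= 1.
  by rewrite ltW//; near: t; apply: near0p_sub; exact: near0_lt.
rewrite /= /genpoly; apply: le_trans (ler_norm_sum _ _ _) _.
rewrite big_seq [leRHS]big_seq; apply: ler_sum => p ps.
rewrite normrM -[leRHS]mulr1 ler_wpM2l//.
rewrite ger0_norm ?powR_ge0// -(powRr0 t%:num).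
have /= p0 := allP s0 _ ps.
apply: ger_powR => //; rewrite t1 andbT.
by near: t; exact: near0pT.
Unshelve. all: by end_near. Qed.

Lemma is_littleo_bounded x : is_littleo x -> near0p [set t | `|x t| <= 1].
Proof.
move=> /cvgr0Pnorm_lt /(_ _ ltr01) x1; near=> t => /=.
have t0 : 0 < t%:num by near: t; exact: near0pT.
have t1 : t%:num <= 1.
  by rewrite ltW//; near: t; apply: near0p_sub; exact: near0_lt.
have -> : x t = x t / t%:num * t%:num by rewrite divfK// gt_eqF.
rewrite normrM -[leRHS]mulr1 ler_pM// ?(ger0_norm (ltW t0))//.
by rewrite ltW//; near: t; exact: x1.
Unshelve. all: by end_near. Qed.

Lemma is_lopoly_bounded x : is_lopoly x -> exists M, near0p [set t | `|x t| <= M].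
Proof.
move=> /is_lopolyP[s s0 xo]; have [M sM] := genpoly_bounded s0.
exists (M + 1); have x1 := is_littleo_bounded xo; near=> t => /=.
rewrite -[x t](subrK (genpoly s t)) addrC (le_trans (ler_normD _ _))//.
by rewrite lerD//; near: t.
Unshelve. all: by end_near. Qed.

Lemma is_littleo_lopoly x : is_littleo x -> is_lopoly x.
Proof.
move=> xo; apply/is_lopolyP; exists [::] => //.
by apply: is_littleo_eq xo => t; rewrite /genpoly big_nil subr0.
Qed.

Definition lopoly_pred : {pred ({nonneg R} -> R)} := fun x => `[< is_lopoly x >].

Lemma lopoly_subring_closed : subring_closed lopoly_pred.
Proof.
split.
- apply/asboolP/is_lopolyP; exists [:: (1, 0)]; first by rewrite /= lexx.
  apply: is_littleo_eq is_littleo0 => t.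
  by rewrite /genpoly big_seq1/= powRr0 mulr1 subrr.
- move=> x y /asboolP/is_lopolyP[s s0 xo] /asboolP/is_lopolyP[u u0 yo].
  apply/asboolP/is_lopolyP; exists (s ++ [seq (- p.1, p.2) | p <- u]).
    by rewrite all_cat s0 all_map.
  apply: is_littleo_eq (is_littleoB xo yo) => t.
  rewrite /genpoly big_cat big_map/=.
  under [X in _ = _ - (_ + X)]eq_bigr do rewrite mulNr.
  by rewrite sumrN [in RHS]opprD opprK [RHS]addrACA opprB [X in _ = _ + X]addrC.
- move=> x y /asboolP xP /asboolP/is_lopolyP[u u0 yo]; have [M xM] := is_lopoly_bounded xP.
  have [s s0 xo] := (is_lopolyP x).1 xP.
  have [N uN] := genpoly_bounded u0.
  apply/asboolP/is_lopolyP.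
  exists [seq (p.1 * q.1, p.2 + q.2) | p <- s, q <- u].
    apply/allP => _ /allpairsP[[p q] [/= ps qu ->]] /=.
    by rewrite addr_ge0 ?(allP s0 p)// (allP u0 q).
  apply: is_littleo_eq (is_littleoD (is_littleoM xM yo) (is_littleoM uN xo)) => t.
  have -> : genpoly [seq (p.1 * q.1, p.2 + q.2) | p <- s, q <- u] t =
            genpoly s t * genpoly u t.
    rewrite /genpoly big_allpairs_dep/= mulr_suml; apply: eq_big_seq => p ps.
    rewrite mulr_sumr; apply: eq_big_seq => q qu.
    have /= p0 := allP s0 _ ps; have /= q0 := allP u0 _ qu.
    have [/eqP|pq0] := eqVneq (p.2 + q.2) 0; last first.
      by rewrite powRD ?(negbTE pq0)// mulrACA.
    rewrite paddr_eq0// => /andP[/eqP -> /eqP ->].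
    by rewrite addr0 powRr0 !mulr1.
  rewrite mulrBr mulrBr [genpoly u t * x t]mulrC addrA subrK.
  by rewrite [genpoly u t * _]mulrC.
Qed.

End LittleOh.

Arguments near0 : clear implicits.
Arguments near0p : clear implicits.

HB.instance Definition _ (R : realType) :=
  GRing.isSubringClosed.Build ({nonneg R} -> R) (@lopoly_pred R)
    (@lopoly_subring_closed R).

Record lopoly (R : realType) := LOPoly {
  lopoly_fun :> {nonneg R} -> R;
  _ : lopoly_fun \in @lopoly_pred R }.

HB.instance Definition _ (R : realType) := [isSub for @lopoly_fun R].
HB.instance Definition _ (R : realType) := [Choice of lopoly R by <:].
HB.instance Definition _ (R : realType) :=
  GRing.SubChoice_isSubComPzRing.Build _ _ (lopoly R)
    (@lopoly_subring_closed R).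

Fact lopoly_oner_neq0 (R : realType) : 1 != 0 :> lopoly R.
Proof.
apply/eqP => /(congr1 (fun x : lopoly R => x (0%:nng : {nonneg R}))) /eqP.
by rewrite oner_eq0.
Qed.
HB.instance Definition _ (R : realType) :=
  GRing.PzSemiRing_isNonZero.Build (lopoly R) (@lopoly_oner_neq0 R).

Section Fermat.
Variable R : realType.

Lemma lopolyP (x : lopoly R) : is_lopoly x.
Proof. exact/asboolP/(valP x). Qed.

(* The ideal of the z with z = o(t); x ~ y iff x - y lies in it. *)
Definition littleo_ideal : {pred lopoly R} := fun z => `[< is_littleo z >].

Lemma littleo_idealr_closed : idealr_closed littleo_ideal.
Proof.
split.
- exact/asboolP/is_littleo0.
- apply/asboolP => /cvgr0Pnorm_lt /(_ _ ltr01) o1.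
  have : near0p R [set t | False].
    near=> t => /=.
    have t0 : 0 < t%:num by near: t; exact: near0pT.
    have t1 : t%:num < 1 by near: t; apply: near0p_sub; exact: near0_lt.
    have : `|1 / t%:num| < 1 by near: t; exact: o1.
    rewrite div1r ger0_norm ?invr_ge0 ?ltW// invf_lt1//.
    by move/(lt_trans t1); rewrite ltxx.
  by move/filter_ex => [].
- move=> a x y /asboolP xo /asboolP yo; apply/asboolP.
  have [M aM] := is_lopoly_bounded (lopolyP a).
  exact: is_littleoD (is_littleoM aM xo) yo.
Unshelve. all: by end_near. Qed.

HB.instance Definition _ := isIdealr.Build (lopoly R) littleo_ideal
  littleo_idealr_closed.

Definition fermat : Type := {ideal_quot littleo_ideal}.

HB.instance Definition _ := GRing.ComNzRing.on fermat.
HB.instance Definition _ := EqQuotient.on fermat.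

Lemma eq_fermatP (x y : lopoly R) :
  \pi_fermat x = \pi_fermat y <-> is_littleo (fun t => x t - y t).
Proof.
split=> [/eqP|xy]; last apply/eqP.
  by rewrite piE => /asboolP.
by rewrite piE; exact/asboolP.
Qed.

Lemma fermat_eq0P (z : lopoly R) :
  \pi_fermat z = 0 <-> is_littleo z.
Proof.
have -> : 0 = \pi_fermat (0 : lopoly R) by rewrite piE.
rewrite eq_fermatP; split; apply: is_littleo_eq => t; first exact: subr0.
by rewrite [RHS]subr0.
Qed.

Lemma fermatD (x y : lopoly R) :
  \pi_fermat x + \pi_fermat y = \pi_fermat (x + y).
Proof. exact: esym (Quotient.pi_add _ x y). Qed.

Lemma fermatM (x y : lopoly R) :
  \pi_fermat x * \pi_fermat y = \pi_fermat (x * y).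
Proof. exact: esym (Quotient.pi_mul _ x y). Qed.

(* Giordano's order on representatives; [le_lopoly_congr] shows that it only
   depends on their classes. *)
Definition le_lopoly (x y : lopoly R) : Prop :=
  exists z : lopoly R, \pi_fermat z = 0 /\
    \forall t \near near0 R, x t <= y t + z t.

Lemma le_lopoly_congr (x x' y y' : lopoly R) :
  \pi_fermat x = \pi_fermat x' -> \pi_fermat y = \pi_fermat y' ->
  le_lopoly x y -> le_lopoly x' y'.
Proof.
move=> /eq_fermatP xx' /eq_fermatP yy' [z [/fermat_eq0P z0 xyz]].
exists (z + (y - y') - (x - x')); split.
  apply/fermat_eq0P; apply: is_littleoB xx'.
  exact: is_littleoD z0 yy'.
apply: filterS xyz => t xyz.
rewrite -[leRHS]/(y' t + (z t + (y t - y' t) - (x t - x' t))).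
by move: xyz => /=; lra.
Qed.

Definition le_fermat : rel fermat :=
  fun x y => `[< le_lopoly (repr x) (repr y) >].

Lemma le_fermat_piP (x y : lopoly R) :
  le_fermat (\pi_fermat x) (\pi_fermat y) <-> le_lopoly x y.
Proof.
split=> [/asboolP|xy]; first by apply: le_lopoly_congr; rewrite reprK.
by apply/asboolP; apply: le_lopoly_congr xy; rewrite reprK.
Qed.

Fact le_fermat_refl : reflexive le_fermat.
Proof.
move=> x; apply/asboolP; exists 0; split; first exact/fermat_eq0P/is_littleo0.
by apply: filterE => t; rewrite [leRHS]addr0.
Qed.

Fact le_fermat_anti : antisymmetric le_fermat.
Proof.
move=> x y /andP[/asboolP[z [/fermat_eq0P z0 xyz]]].
move=> /asboolP[w [/fermat_eq0P w0 yxw]].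
rewrite -[x]reprK -[y]reprK; apply/eq_fermatP.
set u := repr x in xyz yxw *; set v := repr y in xyz yxw *.
have wo := is_littleoN w0.
apply: squeeze_cvgr wo z0.
near=> t; have t0 : 0 < t%:num by near: t; exact: near0pT.
rewrite !ler_pM2r ?invr_gt0//.
have h1 : u t <= v t + z t by near: t; exact: near0p_sub.
have h2 : v t <= u t + w t by near: t; exact: near0p_sub.
by rewrite lerBlDl h1 andbT lerNl opprB lerBlDl.
Unshelve. all: by end_near. Qed.

Fact le_fermat_trans : transitive le_fermat.
Proof.
move=> y x z /asboolP[u [/fermat_eq0P u0 xyu]] /asboolP[v [/fermat_eq0P v0 yzv]].
apply/asboolP; exists (v + u); split.
  by apply/fermat_eq0P; exact: is_littleoD.
near=> t; have h1 : repr x t <= repr y t + u t by near: t.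
have h2 : repr y t <= repr z t + v t by near: t.
apply: le_trans h1 _; rewrite -[leRHS]/(repr z t + (v t + u t)).
by rewrite addrA lerD2r.
Unshelve. all: by end_near. Qed.

HB.instance Definition _ := Order.Le_isPOrder.Build ring_display fermat
  le_fermat_refl le_fermat_anti le_fermat_trans.

Definition is_max (A : set fermat) (m : fermat) : Prop := A m /\ ubound A m.
Definition is_min (A : set fermat) (m : fermat) : Prop := A m /\ lbound A m.

Definition ltF (x y : fermat) : Prop := x <> y /\
  [\/ exists l, [set k | k <= l] x /\ ~ [set k | k <= l] y,
      (exists l, is_max [set k | k <= l] x) /\ (exists h, 0 < h /\ y = x + h) |
      (exists l, is_min [set k | l <= k] y) /\ (exists h, 0 < h /\ x = y - h)].

End Fermat.

(* A copy of T carrying the topology whose subbasis consists of the open rays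
   of the relation lt, which is not required to be an order. *)
Definition ray_space (T : choiceType) (lt : T -> T -> Prop) : Type := T.

Definition open_rays (T : Type) (lt : T -> T -> Prop) : set (set T) :=
  [set A | exists l, A = [set k | lt k l] \/ A = [set k | lt l k]].

HB.instance Definition _ (T : choiceType) (lt : T -> T -> Prop) :=
  Choice.copy (ray_space lt) T.
HB.instance Definition _ (T : choiceType) (lt : T -> T -> Prop) :=
  isSubBaseTopological.Build (ray_space lt) (open_rays lt) id.

(* For a linear order this is the library's order topology. *)
Lemma ray_spaceE d (T : orderType d) :
  @open (ray_space (fun x y : T => (x < y)%O)) = @open (order_topology T).
Proof.
set X := ray_space _.
have rayX A : open_rays (fun x y : T => (x < y)%O) A -> @open X A.
  move=> rA; exists [set A]; last exact: bigcup_set1.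
  move=> _ ->; exists [fset A]%fset; last by rewrite set_fset1 bigcap_set1.
  by move=> B; rewrite in_fset1 => /eqP ->; exact/mem_set.
apply/seteqP; split=> A.
  case=> D' sD' <-; apply: bigcup_open => B /sD'[F Frays <-].
  rewrite -bigsetI_fset_set ?set_fsetK//.
  rewrite big_seq; apply: (big_ind (@open (order_topology T))) => //.
  - exact: openT.
  - exact: openI.
  move=> C /Frays; rewrite inE => -[l [->|->]].
  - by have := @lray_open _ (order_topology T) l; rewrite set_itvE.
  - by have := @rray_open _ (order_topology T) l; rewrite set_itvE.
rewrite [X in X A -> _]openE [X in _ -> X A]openE => Ao x /Ao.
rewrite /interior order_nbhs_itv => -[i [oi xi] iA].
suff iX : @open X [set` i] by apply: filterS iA _; exact: open_nbhs_nbhs.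
have lX l : @open X [set` `]-oo, l[%O].
  by apply: rayX; exists l; left; rewrite set_itvE.
have gX l : @open X [set` `]l, +oo[%O].
  by apply: rayX; exists l; right; rewrite set_itvE.
case: i oi {xi iA} => [[[]l|[]] [[]r|[]]] // _.
- by rewrite set_itv_splitI; apply: openI; [exact: gX|exact: lX].
- by rewrite set_itvE; exact: openT.
Qed.

Definition is_LOTS (X : topologicalType) : Prop :=
  exists (d : Order.disp_t) (o : Order.Total d X),
    @open X = @open (order_topology (Order.Total.Pack o)).

(* Main.v *)
(** Every Fermat real is represented by a finite sum of powers of [t], up to
    [o(t)]. Near [0+] such a sum has constant sign: collect the terms of least
    exponent [a]; if their coefficients add up to [c <> 0], then [c t^a]
    dominates the rest, and otherwise they cancel and there are fewer terms
    left. Hence Giordano's order is total. For a total order that is compatible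
    with addition, each of the three clauses defining [ltF] amounts to [x < y],
    so the open rays of [ltF] are those of Giordano's order. *)

From HB Require Import structures.
Require Import Defs.
From mathcomp Require Import all_boot all_order all_algebra.
From mathcomp Require Import all_classical all_reals all_analysis.
From mathcomp Require Import lra.

Set Implicit Arguments.
Unset Strict Implicit.
Unset Printing Implicit Defensive.

Import Order.TTheory GRing.Theory Num.Theory.

Local Open Scope classical_set_scope.
Local Open Scope ring_scope.
Local Open Scope quotient_scope.

Section EventualSign.
Variable R : realType.
Implicit Types (s : seq (R * R)) (a e : R).

Lemma powR_near0 a e : 0 < a -> 0 < e ->
  near0p R [set t | t%:num `^ a < e].
Proof.
move=> a0 e0; apply: near0p_sub; exists (e `^ a^-1) => /=.
  exact: powR_gt0.
(* The power [t^a] increases and takes the value [e] exactly at [e^(1/a)]. *)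
move=> t /= te; have -> : e = (e `^ a^-1) `^ a.
  by rewrite -powRrM mulVf ?gt_eqF// powRr1// ltW.
by rewrite gt0_ltr_powR// nnegrE// ltW// powR_gt0.
Qed.

(** A term [c t^b] with [b > a] is [c t^(b - a)] times [t^a], and its first factor tends to [0].
    Half of [e] pays for the head, the other half for the tail by induction. *)
Lemma genpoly_dominated s a e : all (fun p => a < p.2) s -> 0 < e ->
  near0p R [set t | `|genpoly s t| <= e * t%:num `^ a].
Proof.
elim: s e => [|[c b] s IHs] e /=.
  move=> _ e0; apply: filterE => t.
  by rewrite /= /genpoly big_nil normr0 mulr_ge0 ?powR_ge0// ltW.
move=> /andP[ab sa] e0.
have e20 : 0 < e / 2 by lra.
have c0 : 0 < `|c| + 1 by rewrite ltr_wpDl.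
have ba0 : 0 < b - a by rewrite subr_gt0.
(* Dividing by [|c| + 1] rather than [|c|] covers [c = 0]. *)
have tb := powR_near0 ba0 (divr_gt0 e20 c0).
have IH := IHs _ sa e20.
near=> t => /=.
have t0 : 0 < t%:num by near: t; exact: near0pT.
rewrite /genpoly big_cons/= (le_trans (ler_normD _ _))//.
rewrite [e]splitr mulrDl lerD//; last by near: t; exact: IH.
have -> : b = (b - a) + a by rewrite subrK.
rewrite powRD; last by rewrite (gt_eqF t0) implybT.
rewrite mulrA normrM [`|_ `^ a|]ger0_norm ?powR_ge0//.
rewrite ler_wpM2r ?powR_ge0// normrM [`|_ `^ _|]ger0_norm ?powR_ge0//.
have : t%:num `^ (b - a) < e / 2 / (`|c| + 1) by near: t; exact: tb.
rewrite ltr_pdivlMr// => /ltW; apply: le_trans.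
by rewrite mulrC ler_wpM2l ?powR_ge0// lerDl.
Unshelve. all: by end_near. Qed.

Lemma exists_min_exponent s : s != [::] ->
  exists2 a, has (fun p => p.2 == a) s & all (fun p => a <= p.2) s.
Proof.
elim: s => // -[c b] [|q s] IHs _ /=; first by exists b; rewrite ?eqxx ?lexx.
have [//|a sa aS] := IHs.
have [ba|ab] := leP b a.
  exists b; first by rewrite eqxx.
  by rewrite lexx; apply: sub_all aS => p; exact: le_trans.
by exists a; [move: sa => /= ->; rewrite orbT|rewrite (ltW ab)].
Qed.

Lemma genpoly_sign s : near0p R [set t | 0 <= genpoly s t] \/
  near0p R [set t | genpoly s t <= 0].
Proof.
(* Induction on the length: when the leading terms cancel, the argument restarts on [s'], which need
   not be the tail of [s]. *)
have [n] := ubnP (size s); elim: n s => // n IHn s sn.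
have [->|/exists_min_exponent[a sa aS]] := eqVneq s [::].
  by left; apply: filterE => t; rewrite /= /genpoly big_nil.
pose s' := [seq p <- s | p.2 != a].
pose c := \sum_(p <- s | p.2 == a) p.1.
have sE t : genpoly s t = c * t%:num `^ a + genpoly s' t.
  rewrite /genpoly (bigID (fun p => p.2 == a))/= big_filter; congr +%R.
  by rewrite mulr_suml; apply: eq_bigr => p /eqP ->.
have s'a : all (fun p => a < p.2) s'.
  apply/allP => p; rewrite mem_filter => /andP[pa ps].
  by rewrite lt_neqAle eq_sym pa (allP aS).
have [c0|c0|c0] := ltgtP c 0.
(* Domination with [e = |c|] is enough, since only a weak sign is claimed. *)
- right; have Nc0 : 0 < - c by rewrite oppr_gt0.
  apply: filterS (genpoly_dominated s'a Nc0) => t /= h.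
  by rewrite sE; have := ler_norm (genpoly s' t); lra.
- left; apply: filterS (genpoly_dominated s'a c0) => t /= h.
  by rewrite sE; have := ler_norm (- genpoly s' t); rewrite normrN; lra.
- have sE' t : genpoly s t = genpoly s' t by rewrite sE c0 mul0r add0r.
  (* The exponent [a] is attained in [s], so the filter drops at least one term. *)
  have s's : (size s' < n)%N.
    rewrite size_filter -ltnS; apply: leq_trans sn.
    by rewrite ltnS -(count_predC (fun p => p.2 == a)) -[ltnLHS]add0n ltn_add2r -has_count.
  by case: (IHn s' s's) => h; [left|right]; apply: filterS h => t; rewrite /= sE'.
Qed.

End EventualSign.

Section Order.
Variable R : realType.

(* The value at [0] of an [o(t)] is free, so [t = 0] imposes nothing. *)
Lemma le_lopoly_near0p (x y : lopoly R) (w : {nonneg R} -> R) :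
  is_littleo w -> near0p R [set t | x t <= y t + w t] -> le_lopoly x y.
Proof.
move=> wo xyw.
pose z t := if t%:num == 0 then x t - y t else w t.
have zo : is_littleo z.
  apply: cvg_trans wo; apply: near_eq_cvg; near=> t.
  have t0 : 0 < t%:num by near: t; exact: near0pT.
  by rewrite /z gt_eqF.
have zP : z \in @lopoly_pred R by apply/asboolP/is_littleo_lopoly.
exists (LOPoly zP); split; first exact/fermat_eq0P.
have : near0 R [set t | 0 < t%:num -> x t <= y t + w t] := xyw.
apply: filterS => t /= {}xyw; rewrite /z; case: eqP => [_|/eqP t0]; first by lra.
by apply: xyw; rewrite lt_neqAle eq_sym t0 /=.
Unshelve. all: by end_near. Qed.

(** The difference of two representatives is a [genpoly] of eventually constant sign plus an [o(t)];
    that remainder, or its opposite, is the slack which Giordano's order allows. *)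
Lemma le_fermat_total : total (@le_fermat R).
Proof.
move=> x y; rewrite -[x]reprK -[y]reprK.
set u := repr x; set v := repr y.
have /is_lopolyP[s _] := lopolyP (u - v).
rewrite -[X in is_littleo X]/(fun t => u t - v t - genpoly s t) => wo.
have [h|h] := genpoly_sign s; apply/orP; [right|left]; apply/le_fermat_piP.
  apply: le_lopoly_near0p (is_littleoN wo) _; apply: filterS h => t /= h.
  by move: h; lra.
apply: le_lopoly_near0p wo _; apply: filterS h => t /= h.
by move: h; lra.
Qed.

HB.instance Definition _ := Order.POrder_isTotal.Build ring_display (fermat R)
  le_fermat_total.

Lemma ltr_fermatDr (x h : fermat R) : 0 < h -> x < x + h.
Proof.
move=> h0; rewrite lt_neqAle; apply/andP; split.
  by rewrite -[X in X != _]addr0 (inj_eq (addrI x)) lt_eqF.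
rewrite -[_ <= _]/(le_fermat x (x + h)).
move/ltW: h0; rewrite -[0 <= h]/(le_fermat 0 h).
rewrite -[x]reprK -[h]reprK fermatD.
have -> : 0 = \pi_(fermat R) (0 : lopoly R) by rewrite piE.
(* The slack [z] of [0 <= h] serves again, because [x] cancels pointwise. *)
move=> /le_fermat_piP[z [z0 hz]]; apply/le_fermat_piP; exists z; split => //.
apply: filterS hz => t hz.
rewrite -[leRHS]/(repr x t + repr h t + z t) -addrA lerDl.
exact: hz.
Qed.

Lemma ltFE : @ltF R = (fun x y : fermat R => x < y).
Proof.
apply/funext => x; apply/funext => y; apply/propext; split.
  move=> [_ [[l [/= xl yl]]|[_ [h [h0 ->]]]|[_ [h [h0 ->]]]]].
  - by rewrite ltNge; apply/negP => yx; apply: yl; exact: le_trans xl.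
  - exact: ltr_fermatDr.
  - by rewrite -[ltRHS](subrK h); exact: ltr_fermatDr.
move=> xy; split; first by apply/eqP; rewrite lt_eqF.
(* The ray cut at [l = x] separates any [x < y], so the first clause alone yields this direction. *)
apply: Or31; exists x; split => /=; first exact: lexx.
by apply/negP; rewrite -ltNge.
Qed.

End Order.

Theorem theorem3p2 (R : realType) : is_LOTS (ray_space (@ltF R)).
Proof.
rewrite ltFE; exists ring_display, (Order.Total.class (fermat R)).
exact: ray_spaceE.
Qed.
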